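(* Fix $r\ge0$ and $n\ge0$. The map $\pi\mapsto(P_d^r(\pi),Q_d^r(\pi))$ is a bijection from $B_n$ onto the set of pairs $(P,Q)$ of standard domino tableaux of the same shape $\lambda\in\mathcal P_r(n)$. Moreover, for every $\pi\in B_n$, \[ tc(\pi)=sp(P_d^r(\pi))+sp(Q_d^r(\pi)), \] where $tc(\pi)$ is the number of barred letters of $\pi$.
   Context: Partitions are identified with Young diagrams in English notation: cell $(k,l)$ lies in row $k$ (from the top) and column $l$ (from the left). A domino is a set of two cells sharing an edge (vertical if in one column). $\delta_r=(r,r-1,\dots,1)$; every partition has a 2-core (obtained by repeatedly removing dominoes while staying a partition) equal to a unique $\delta_r$; $\mathcal P_r(n)$ is the set of partitions with 2-core $\delta_r$ and size $|\delta_r|+2n$. A standard domino tableau (SDT) of shape $\lambda\in\mathcal P_r(n)$ is a chain $\delta_r=\lambda^0\subset\cdots\subset\lambda^n=\lambda$ with each $\lambda^k/\lambda^{k-1}$ a domino; $sp(D)$ is half the number of vertical dominoes. $B_n$ is the set of words $\pi=\pi_1\cdots\pi_n$ in letters $\{1,\dots,n,\bar1,\dots,\bar n\}$ in which each $k\in[n]$ occurs exactly once, barred or unbarred. Growth diagram: $M(i,j)=1$ if $\pi_i=j$, $-1$ if $\pi_i=\bar j$, $0$ otherwise. Partitions $\lambda_{(i,j)}$, $1\le i,j\le n+1$, with $\lambda_{(1,j)}=\lambda_{(i,1)}=\delta_r$; for $i,j\in[n]$, with $\lambda=\lambda_{(i,j)},\mu=\lambda_{(i+1,j)},\nu=\lambda_{(i,j+1)}$,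 $\rho=\lambda_{(i+1,j+1)}$ is: (1) if $M(i,j)=1$ (then $\lambda=\mu=\nu$), $\lambda$ with two cells appended to its first row; (2) if $M(i,j)=-1$ (then $\lambda=\mu=\nu$), $\lambda$ with two cells appended to its first column; (3) if $M(i,j)=0$ and $\lambda=\mu$ or $\lambda=\nu$, the largest of $\lambda,\mu,\nu$; (4) otherwise, with dominoes $\gamma=\nu/\lambda$, $\gamma'=\mu/\lambda$: if disjoint, $\lambda\cup\gamma\cup\gamma'$; if they share exactly the cell $(k,l)$, $\lambda\cup\gamma\cup\gamma'\cup\{(k+1,l+1)\}$; if $\gamma=\gamma'$ vertical in column $l$, $\lambda\cup\gamma$ with two cells appended at the bottom of column $l+1$; if $\gamma=\gamma'$ horizontal in row $k$, $\lambda\cup\gamma$ with two cells appended at the end of row $k+1$. Consecutive partitions in the last row/column differ by one domino. $P_d^r(\pi)$ is the SDT given by the chain $\lambda_{(n+1,1)}\subset\cdots\subset\lambda_{(n+1,n+1)}$ and $Q_d^r(\pi)$ the SDT given by $\lambda_{(1,n+1)}\subset\cdots\subset\lambda_{(n+1,n+1)}$. *)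

(* Defs.v *)
(* Conventions: rows and columns are 0-indexed here
   (the paper's cell (k,l) is our cell (k-1,l-1)); positions of the word
   and of the growth diagram are likewise 0-indexed. *)
From mathcomp Require Import all_boot all_order all_algebra.
Set Implicit Arguments.
Unset Strict Implicit.
Unset Printing Implicit Defensive.

Definition part := seq nat.

Definition is_part (la : part) : bool :=
  sorted geq la && all (fun x => 0 < x) la.

Definition in_cell (la : part) (c : nat * nat) : bool := c.2 < nth 0 la c.1.

Definition subpart (la mu : part) : bool :=
  all (fun k => nth 0 la k <= nth 0 mu k) (iota 0 (size la)).

Definition skew (mu la : part) : seq (nat * nat) :=
  flatten [seq [seq (k, l) | l <- iota (nth 0 la k) (nth 0 mu k - nth 0 la k)]
          | k <- iota 0 (size mu)].

Definition is_domino (s : seq (nat * nat)) : bool :=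
  match s with
  | [:: c1; c2] => ((c2.1 == c1.1) && (c2.2 == c1.2.+1))
                   || ((c2.1 == c1.1.+1) && (c2.2 == c1.2))
  | _ => false
  end.

Definition is_vdomino (s : seq (nat * nat)) : bool :=
  match s with
  | [:: c1; c2] => (c2.1 == c1.1.+1) && (c2.2 == c1.2)
  | _ => false
  end.

Definition dstep (la mu : part) : bool :=
  [&& is_part la, is_part mu, subpart la mu & is_domino (skew mu la)].

Definition delta (r : nat) : part := rev (iota 1 r).

(* c is the 2-core of la: c is a partition from which no domino can be removed,
   and la is obtained from c by successively adding dominoes (equivalently, c is
   obtained from la by repeatedly removing dominoes while staying a partition). *)
Definition no_removable_domino (c : part) : Prop :=
  forall mu : part, ~~ dstep mu c.

Definition has_2core (la c : part) : Prop :=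
  is_part c /\ no_removable_domino c /\
  exists s : seq part, path dstep c s /\ last c s = la.

Definition in_Prn (r n : nat) (la : part) : Prop :=
  has_2core la (delta r) /\ sumn la = sumn (delta r) + 2 * n.

(* An SDT is the chain delta_r = la^0 ⊂ ... ⊂ la^n = la, as a list of partitions. *)
Definition is_SDT (r : nat) (la : part) (T : seq part) : Prop :=
  match T with
  | [::] => False
  | c :: s => c = delta r /\ path dstep c s /\ last c s = la
  end.

Definition nvert (T : seq part) : nat :=
  count (fun p : part * part => is_vdomino (skew p.2 p.1)) (zip T (behead T)).

Definition sp (T : seq part) : rat := (nvert T)%:R / 2%:R.

(* A letter is (k, b): the letter k, barred iff b = true. *)
Definition sword := seq (nat * bool).

Definition in_Bn (n : nat) (w : sword) : Prop :=
  size w = n /\ perm_eq (map fst w) (iota 1 n).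

Definition tc (w : sword) : nat := count snd w.

(* M(i,j) (0-indexed): Some false = 1, Some true = -1, None = 0. *)
Definition Mentry (w : sword) (i j : nat) : option bool :=
  let x := nth (0, false) w i in
  if x.1 == j.+1 then Some x.2 else None.

Definition pmax (a b : part) : part :=
  mkseq (fun k => maxn (nth 0 a k) (nth 0 b k)) (maxn (size a) (size b)).

Definition add_cell (la : part) (c : nat * nat) : part :=
  set_nth 0 la c.1 (maxn (nth 0 la c.1) c.2.+1).

Definition col_len (la : part) (l : nat) : nat := count (fun x => l < x) la.

Definition add_two_row (la : part) (k : nat) : part :=
  let a := nth 0 la k in add_cell (add_cell la (k, a)) (k, a.+1).

Definition add_two_col (la : part) (l : nat) : part :=
  let c := col_len la l in add_cell (add_cell la (c, l)) (c.+1, l).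

Definition largest3 (la mu nu : part) : part :=
  let b := if sumn mu <= sumn nu then nu else mu in
  if sumn la <= sumn b then b else la.

Definition rule4 (la mu nu : part) : part :=
  let g := skew nu la in
  let g' := skew mu la in
  if g == g' then
    match g with
    | [:: c1; c2] =>
        if is_vdomino g then add_two_col nu c1.2.+1
        else add_two_row nu c1.1.+1
    | _ => nu
    end
  else
    match [seq c <- g | c \in g'] with
    | [::] => pmax nu mu
    | [:: c] => add_cell (pmax nu mu) (c.1.+1, c.2.+1)
    | _ => pmax nu mu
    end.

(* local rule: rho from la = la(i,j), mu = la(i+1,j), nu = la(i,j+1) *)
Definition local_rule (m : option bool) (la mu nu : part) : part :=
  match m with
  | Some false => add_two_row la 0
  | Some true => add_two_col la 0
  | None => if (la == mu) || (la == nu) then largest3 la mu nu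
            else rule4 la mu nu
  end.

(* Given row i of the diagram (prev) compute the rest of row i+1,
   mu being the entry of row i+1 in column j. *)
Fixpoint next_row_aux (w : sword) (i j : nat) (mu : part) (prev : seq part)
  : seq part :=
  match prev with
  | la :: ((nu :: _) as rest) =>
      let rho := local_rule (Mentry w i j) la mu nu in
      rho :: next_row_aux w i j.+1 rho rest
  | _ => [::]
  end.

Definition next_row (r : nat) (w : sword) (i : nat) (prev : seq part) : seq part :=
  delta r :: next_row_aux w i 0 (delta r) prev.

Fixpoint growth_row (r : nat) (w : sword) (i : nat) : seq part :=
  match i with
  | 0 => nseq (size w).+1 (delta r)
  | i'.+1 => next_row r w i' (growth_row r w i')
  end.

Definition Pd (r : nat) (w : sword) : seq part := growth_row r w (size w).

Definition Qd (r : nat) (w : sword) : seq part :=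
  [seq last (delta r) (growth_row r w i) | i <- iota 0 (size w).+1].

(* Main.v *)
(* Every local rule of the growth diagram falls under one of a few patterns
   ([grow] below): if the dominoes nu/la and mu/la differ, rho is the only
   partition obtained by adding one domino to mu and one to nu; if they coincide
   as a horizontal domino in row k, rho/nu is the horizontal domino in row k+1, and an entry 1 of the matrix acts
   like a virtual horizontal domino in row -1; if they coincide as a vertical
   domino in column l, rho/nu is the vertical domino of column l+1, and an entry
   -1 acts like a virtual vertical domino in column -1.  In each pattern
   (m, la) can be recovered from (mu, nu, rho), and every triple (mu, nu, rho)
   occurs, so the diagram can be rebuilt from its last row and column.  As no
   domino can be removed from delta_r, the rebuilt first row and column are
   constant; whether la and mu coincide changes from left to right exactly at the
   nonzero entries of a row, which then has exactly one of them.  For the spin,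
   v(nu, rho) + v(mu, rho) = v(la, nu) + v(la, mu) + 2 [m = -1], where v counts
   vertical dominoes; this telescopes over the diagram. *)
Require Import Defs.
From mathcomp Require Import all_boot all_order all_algebra.
From mathcomp Require Import zify.
(* all_algebra has a [skew] of its own. *)
Import Defs.
Set Implicit Arguments.
Unset Strict Implicit.
Unset Printing Implicit Defensive.

(** * Partitions and domino steps *)

Lemma is_partP la :
  is_part la <-> (forall i, nth 0 la i.+1 <= nth 0 la i) /\
                 (forall i, i < size la -> 0 < nth 0 la i).
Proof.
split=> [/andP[/(sortedP 0) ord /(all_nthP 0) pos]|[ord pos]].
  split=> // i; case: (ltnP i.+1 (size la)) => [/ord //|le_sz].
  by rewrite nth_default.
by apply/andP; split; [apply/(sortedP 0) => i _; apply: ord | apply/(all_nthP 0)].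
Qed.

Lemma part_le la i j : is_part la -> i <= j -> nth 0 la j <= nth 0 la i.
Proof.
case/is_partP=> ord _; elim: j => [|j IHj]; first by rewrite leqn0 => /eqP->.
by rewrite leq_eqVlt => /predU1P[->//|/IHj]; apply/leq_trans/ord.
Qed.

Lemma part_ext la mu :
  is_part la -> is_part mu -> nth 0 la =1 nth 0 mu -> la = mu.
Proof.
move=> /is_partP[_ pla] /is_partP[_ pmu] E.
suff Esz: size la = size mu by apply: (eq_from_nth Esz) => i _; apply: E.
case: (ltngtP (size la) (size mu)) => // lt_sz.
  by have := pmu _ lt_sz; rewrite -E nth_default.
by have := pla _ lt_sz; rewrite E nth_default.
Qed.

Lemma part_of_fun (g : nat -> nat) N :
  (forall i, g i.+1 <= g i) -> g N = 0 -> exists la, is_part la /\ nth 0 la =1 g.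
Proof.
(* Cutting at the least zero of [g] leaves only positive rows. *)
move=> ord gN0; have exN: exists N, g N == 0 by exists N; apply/eqP.
case: (ex_minnP exN) => m /eqP gm0 min_m; exists (mkseq g m).
have Enth: nth 0 (mkseq g m) =1 g.
  move=> i; case: (ltnP i m) => [lt_im|le_mi]; first by rewrite nth_mkseq.
  rewrite nth_default ?size_mkseq //; elim: i le_mi => [|i IHi].
    by rewrite leqn0 => /eqP Em; rewrite -Em gm0.
  rewrite leq_eqVlt => /predU1P[<- //|/IHi gi0].
  by apply/esym/eqP; rewrite -leqn0 gi0 ord.
split=> //; apply/is_partP; split=> i; rewrite !Enth // size_mkseq => lt_im.
by rewrite lt0n; apply/negP => /min_m; rewrite leqNgt lt_im.
Qed.

(** Row lengths decrease, so the rows longer than [l] form an initial segment, whose size is the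
    index of the first row missing column [l]. *)
Lemma col_lenP la l i : is_part la -> (i < col_len la l) = (l < nth 0 la i).
Proof.
case/andP=> + _; rewrite /col_len; elim: la i => [|x s IHs] i //=.
  by rewrite nth_nil.
move=> x_s; have /IHs{}IHs := path_sorted x_s.
case: (ltnP l x) => [lt_lx|le_xl] /=; first by case: i.
have s0: count (fun y => l < y) s = 0.
  apply/eqP; rewrite -leqn0 leqNgt -has_count; apply/hasPn => y s_y.
  rewrite -leqNgt; apply: leq_trans le_xl.
  have/allP := order_path_min (rev_trans leq_trans) x_s; exact.
rewrite s0; case: i => [|i] /=; first by rewrite [l < x]ltnNge le_xl.
by rewrite -IHs s0.
Qed.

Lemma nth_add_cell la c i :
  nth 0 (add_cell la c) i
  = if i == c.1 then maxn (nth 0 la i) c.2.+1 else nth 0 la i.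
Proof. by rewrite nth_set_nth /=; case: eqP => [->|]. Qed.

Lemma add_cell_pos la c : c.1 <= size la ->
  all (leq 1) la -> all (leq 1) (add_cell la c).
Proof.
move=> le_c /(all_nthP 0) pos; apply/(all_nthP 0) => i.
rewrite size_set_nth nth_add_cell => lt_i; case: eqP => [_|/eqP ne_i].
  by rewrite leq_max orbT.
by apply: pos; lia.
Qed.

Lemma nth_pmax la mu i : nth 0 (pmax la mu) i = maxn (nth 0 la i) (nth 0 mu i).
Proof.
rewrite /pmax; case: (ltnP i (maxn (size la) (size mu))) => lt_i.
  by rewrite nth_mkseq.
by rewrite !nth_default ?size_mkseq //; lia.
Qed.

Lemma pmax_part la mu : is_part la -> is_part mu -> is_part (pmax la mu).
Proof.
move=> /is_partP[ola pla] /is_partP[omu pmu]; apply/is_partP; split=> i.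
  by rewrite !nth_pmax; have := ola i; have := omu i; lia.
by rewrite size_mkseq nth_pmax leq_max; have := pla i; have := pmu i; lia.
Qed.

(* A domino is recorded as (is it vertical?, its top row). *)
Definition dom_row (d : bool * nat) (i : nat) : nat :=
  if d.1 then (i == d.2) + (i == d.2.+1) else (i == d.2).*2.

(** The last field puts the two cells of a vertical domino into one column; the cells of a
    horizontal one are adjacent because both are appended to the same row. *)
Record step (d : bool * nat) (la mu : part) : Prop := Step {
  step_src : is_part la;
  step_tgt : is_part mu;
  step_nth : forall i, nth 0 mu i = nth 0 la i + dom_row d i;
  step_vert : d.1 -> nth 0 la d.2 = nth 0 la d.2.+1 }.

(** The order of the cells is the one in which [skew] lists them, so [step_skew] is an equality of
    lists. *)
Definition dom_cells (d : bool * nat) (la : part) : seq (nat * nat) :=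
  let l := nth 0 la d.2 in
  [:: (d.2, l); if d.1 then (d.2.+1, l) else (d.2, l.+1)].

Lemma dom_row_inj d d' : dom_row d =1 dom_row d' -> d = d'.
Proof.
case: d d' => [[] k] [[] k'] E; have := E k; have := E k'; have := E k.+1;
  rewrite /dom_row /= => *; try (congr (_, _)); lia.
Qed.

Lemma step_inj d d' la mu : step d la mu -> step d' la mu -> d = d'.
Proof.
move=> [_ _ E _] [_ _ E' _]; apply: dom_row_inj => i.
by apply: (@addnI (nth 0 la i)); rewrite -E E'.
Qed.

Lemma step_tgt_inj d la mu mu' : step d la mu -> step d la mu' -> mu = mu'.
Proof.
by move=> [_ p E _] [_ p' E' _]; apply: part_ext => // i; rewrite E E'.
Qed.

Lemma step_src_inj d la la' mu : step d la mu -> step d la' mu -> la = la'.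
Proof.
move=> [p _ E _] [p' _ E' _]; apply: part_ext => // i.
by apply: (@addIn (dom_row d i)); rewrite -E E'.
Qed.

Lemma step_irr d la : ~ step d la la.
Proof.
move=> [_ _ E _]; have := E d.2; rewrite /dom_row; case: d.1; lia.
Qed.

Lemma sumn_nth la N : size la <= N -> sumn la = \sum_(i < N) nth 0 la i.
Proof.
elim: la N => [|x s IHs] [|N] //= le_N.
- by rewrite big_ord0.
- by rewrite big1 // => i _; rewrite nth_nil.
by rewrite big_ord_recl /= (IHs N).
Qed.

Lemma sum_dom_row d N : d.2.+1 < N -> \sum_(i < N) dom_row d i = 2.
Proof.
move=> lt_N.
have sum1 k : k < N -> \sum_(i < N) (i == k :> nat) = 1.
  move=> lt_k; rewrite (bigD1 (Ordinal lt_k)) //= eqxx big1 // => i.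
  by rewrite -val_eqE /= => /negPf->.
rewrite /dom_row; case: d.1; first by rewrite big_split /= !sum1 // ltnW.
under eq_bigr do rewrite -addnn.
by rewrite big_split /= !sum1 // ltnW.
Qed.

Lemma step_sumn d la mu : step d la mu -> sumn mu = sumn la + 2.
Proof.
move=> [_ _ E _]; pose N := (size la + size mu + d.2).+2.
rewrite (@sumn_nth mu N) 1?(@sumn_nth la N); try by rewrite /N; lia.
rewrite -(@sum_dom_row d N) 1?/N; last by lia.
by rewrite -big_split /=; apply: eq_bigr => i _; apply: E.
Qed.

Lemma flatten_nil (T : Type) (I : eqType) (F : I -> seq T) s :
  {in s, forall i, F i = [::]} -> flatten [seq F i | i <- s] = [::].
Proof.
elim: s => //= x s IHs F0; rewrite F0 ?mem_head //= IHs // => i s_i.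
by rewrite F0 // inE s_i orbT.
Qed.

Lemma skew_id la : skew la la = [::].
Proof. by apply: flatten_nil => k _; rewrite subnn. Qed.

Lemma iota_cut k N : k < N ->
  iota 0 N = iota 0 k ++ k :: iota k.+1 (N - k.+1).
Proof.
move=> lt_k; rewrite -[in LHS](subnKC lt_k) iotaD -addn1 iotaD -catA /=.
by rewrite !addn1.
Qed.

Lemma step_skew d la mu : step d la mu -> skew mu la = dom_cells d la.
Proof.
case: d => b k [pla pmu E V]; rewrite /skew.
have row0 i : dom_row (b, k) i = 0 ->
    [seq (i, l) | l <- iota (nth 0 la i) (nth 0 mu i - nth 0 la i)] = [::].
  by move=> d0; rewrite E d0 addn0 subnn.
(* [skew] scans only the rows of [mu]; a row that receives a cell is among them. *)
have sz i : 0 < dom_row (b, k) i -> i < size mu.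
  move=> d_gt0; rewrite ltnNge; apply/negP => /(nth_default 0).
  by rewrite E; lia.
have lt_k : k < size mu by apply: sz; rewrite /dom_row /=; case: (b); lia.
rewrite (iota_cut lt_k) map_cat flatten_cat /=.
rewrite flatten_nil ?E /=; last first.
  by move=> i; rewrite mem_iota => ?; apply: row0; rewrite /dom_row /=; case: (b); lia.
rewrite addKn /dom_cells; case: b => [|] in V E row0 sz *; last first.
  rewrite /dom_row /= eqxx /= flatten_nil // => i; rewrite mem_iota => ?.
  by apply: row0; rewrite /dom_row /=; lia.
have lt_k1 : k.+1 < size mu by apply: sz; rewrite /dom_row /=; lia.
rewrite /dom_row /= eqxx (_ : size mu - k.+1 = (size mu - k.+2).+1); last by lia.
rewrite [k == _]eqn_leq ltnn andbF /= E addKn /dom_row /= eqxx.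
rewrite [_ == k]eqn_leq ltnn /= -V //= flatten_nil // => i; rewrite mem_iota => ?.
by apply: row0; rewrite /dom_row /=; lia.
Qed.

Lemma step_dstep d la mu : step d la mu -> dstep la mu.
Proof.
move=> st; have [pla pmu E _] := st; rewrite /dstep pla pmu /=.
apply/andP; split; first by apply/allP => i _; rewrite E leq_addr.
by rewrite (step_skew st) /dom_cells; case: d.1; rewrite /= !eqxx ?orbT.
Qed.

Lemma vdom_step d la mu : step d la mu -> is_vdomino (skew mu la) = d.1.
Proof.
move/step_skew->; rewrite /dom_cells; case: d.1; rewrite /= ?eqxx //.
by rewrite eqn_leq ltnn andbF.
Qed.

Lemma mem_skew la mu c :
  (c \in skew mu la) = (nth 0 la c.1 <= c.2 < nth 0 mu c.1).
Proof.
case: c => k l; apply/flatten_mapP/idP => /= [[i _ /mapP[j + [-> ->]]]|kl].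
  by rewrite mem_iota; lia.
exists k; last by apply/mapP; exists l; rewrite // mem_iota; lia.
rewrite mem_iota add0n /= ltnNge; apply/negP => /(nth_default 0); lia.
Qed.

Lemma dstepP la mu : dstep la mu -> exists d, step d la mu.
Proof.
case/and4P=> pla pmu /allP sub.
have {sub} le i : nth 0 la i <= nth 0 mu i.
  case: (ltnP i (size la)) => [lt_i|le_i]; last by rewrite nth_default.
  by apply: sub; rewrite mem_iota.
have := @mem_skew la mu.
case: (skew mu la) => [|[k l] [|[k' l'] []]] //= memE.
(* A row that gets longer contributes its first new cell to the skew shape, so it is one of the two
   rows of the listed cells. *)
have row i : [\/ nth 0 mu i = nth 0 la i, i = k | i = k'].
  have := memE (i, nth 0 la i); rewrite !inE !xpair_eqE /=.
  case: (eqVneq i k) => [|?]; first by constructor 2.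
  case: (eqVneq i k') => [|?]; first by constructor 3.
  by have := le i; constructor 1; lia.
have M i j := memE (i, j).
case/orP=> /andP[/eqP Ek /eqP El]; subst k' l'; [exists (false, k)|exists (true, k)].
  (* Membership is tested at the two listed cells and at the first and last new cell of the row,
     which pins down both ends of the row. *)
  have Ek: nth 0 mu k = nth 0 la k + 2.
    have := M k l; have := M k l.+1; have := M k (nth 0 la k).
    by have := M k (nth 0 mu k).-1; rewrite !inE !xpair_eqE /=; lia.
  split=> // i; rewrite /dom_row /=; case: (eqVneq i k) => [->|]; first by lia.
  by case: (row i); lia.
have El: nth 0 la k = l /\ nth 0 mu k = l.+1.
  have := M k l; have := M k (nth 0 la k); have := M k (nth 0 mu k).-1.
  by rewrite !inE !xpair_eqE /=; lia.
have El1: nth 0 la k.+1 = l /\ nth 0 mu k.+1 = l.+1.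
  have := M k.+1 l; have := M k.+1 (nth 0 la k.+1).
  by have := M k.+1 (nth 0 mu k.+1).-1; rewrite !inE !xpair_eqE /=; lia.
split=> //= [i|]; last by lia.
rewrite /dom_row /=; case: (eqVneq i k) => [->|?]; first by lia.
case: (eqVneq i k.+1) => [->|?]; first by lia.
by case: (row i); lia.
Qed.

(** * The local rule *)

Definition wstep (la mu : part) : Prop := la = mu \/ exists d, step d la mu.

(** In [grow_hv] and [grow_vh] the two dominoes share their top left cell, and [rho] completes them
    to a two by two square in rows [k] and [k.+1]. In [grow_vv] the equation on row lengths says
    that the second domino lies in the column right after the first; in [grow_minus] it says that
    the domino lies in column 0. The row [c] is left free, since the column determines it
    ([vstep_tgt_row_inj]). *)
Inductive grow : option bool -> part -> part -> part -> part -> Prop :=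
| grow_left la nu : wstep la nu -> grow None la la nu nu
| grow_top la mu : wstep la mu -> grow None la mu la mu
| grow_comm d d' la mu nu rho : d <> d' ->
    step d la nu -> step d' la mu -> step d mu rho -> step d' nu rho ->
    grow None la mu nu rho
| grow_hv k la mu nu rho :
    step (false, k) la nu -> step (true, k) la mu ->
    step (true, k) mu rho -> step (false, k.+1) nu rho ->
    grow None la mu nu rho
| grow_vh k la mu nu rho :
    step (true, k) la nu -> step (false, k) la mu ->
    step (false, k.+1) mu rho -> step (true, k) nu rho ->
    grow None la mu nu rho
| grow_hh k la nu rho :
    step (false, k) la nu -> step (false, k.+1) nu rho -> grow None la nu nu rho
| grow_vv k c la nu rho :
    step (true, k) la nu -> step (true, c) nu rho -> nth 0 nu c = nth 0 nu k ->
    grow None la nu nu rho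
| grow_plus la rho : step (false, 0) la rho -> grow (Some false) la la la rho
| grow_minus c la rho :
    step (true, c) la rho -> nth 0 la c = 0 -> grow (Some true) la la la rho.

Lemma grow_sym m la mu nu rho : grow m la mu nu rho -> grow m la nu mu rho.
Proof.
case=> {m la mu nu rho}.
- exact: grow_top.
- exact: grow_left.
- by move=> d d' la mu nu rho /nesym ne *; apply: (grow_comm ne).
- by move=> k la mu nu rho *; apply: (@grow_vh k).
- by move=> k la mu nu rho *; apply: (@grow_hv k).
- by move=> k la nu rho *; apply: (@grow_hh k).
- by move=> k c la nu rho *; apply: (@grow_vv k c).
- by move=> la rho; apply: grow_plus.
- by move=> c la rho; apply: grow_minus.
Qed.

Lemma add_two_row_step la k : is_part la ->
  (0 < k -> nth 0 la k + 2 <= nth 0 la k.-1) ->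
  step (false, k) la (add_two_row la k).
Proof.
move=> pla room; have [ord pos] := (is_partP la).1 pla.
have E i : nth 0 (add_two_row la k) i = nth 0 la i + dom_row (false, k) i.
  by rewrite !nth_add_cell /dom_row /=; case: eqP => [->|]; lia.
have le_k: k <= size la.
  case: k room {E} => // k room; rewrite ltnNge; apply/negP => le_k.
  by have := room isT; rewrite [nth 0 la k.+1.-1]nth_default //; lia.
split=> //; apply/is_partP; split=> [i|].
  have := ord i; rewrite !E /dom_row /=; case: (eqVneq i.+1 k) => [Ek|]; last by lia.
  by move: room; rewrite -Ek /=; lia.
have /andP[_ posla] := pla.
apply/(all_nthP 0); apply: add_cell_pos => /=; last exact: add_cell_pos.
by rewrite size_set_nth /=; lia.
Qed.

(** The hypotheses say that the first two rows below column [l] both stop just before it, so each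
    new cell is attached to the end of its row. *)
Lemma add_two_col_step la l (c := col_len la l) : is_part la ->
  nth 0 la c = l -> nth 0 la c.+1 = l -> step (true, c) la (add_two_col la l).
Proof.
move=> pla lac lac1; have [ord pos] := (is_partP la).1 pla.
have E i : nth 0 (add_two_col la l) i = nth 0 la i + dom_row (true, c) i.
  rewrite !nth_add_cell -/c /dom_row /=.
  case: (eqVneq i c.+1) => [->|_].
    by rewrite gtn_eqF // lac1; lia.
  by case: (eqVneq i c) => [->|_]; rewrite ?lac; lia.
split=> //; last by rewrite /= lac.
  apply/is_partP; split=> [i|].
    have := ord i; rewrite !E /dom_row /=; case: (eqVneq i.+1 c) => [Ec|].
      by have := col_lenP l i pla; move: lac; rewrite -/c -Ec; lia.
    case: (eqVneq i c) => [->|?]; first by lia.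
    by case: (eqVneq i c.+1) => [->|?]; lia.
  have /andP[_ posla] := pla.
  apply/(all_nthP 0); apply: add_cell_pos => /=.
    by rewrite size_set_nth /= -/c; lia.
  by apply: add_cell_pos => //; apply: count_size.
Qed.

Lemma dom_cells_inj d d' la : dom_cells d la = dom_cells d' la -> d = d'.
Proof.
case: d d' => [b k] [b' k']; rewrite /dom_cells /=.
case: b b' => [] [] [] // *; subst => //; lia.
Qed.

(** Dominoes added to one partition that meet a common row share the first free cell of that row.
    Disjointness is therefore a condition on rows, and under it the union adds both dominoes
    independently. *)
Lemma pmax_step d d' la mu nu : step d la nu -> step d' la mu ->
  (forall i, 0 < dom_row d i -> dom_row d' i = 0) ->
  step d mu (pmax nu mu) /\ step d' nu (pmax nu mu).
Proof.
move=> [pla pnu E V] [_ pmu E' V'] dis.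
have prho := pmax_part pnu pmu.
split; split=> //.
- by move=> i; rewrite nth_pmax E E'; have := dis i; lia.
- move=> dv; rewrite !E'; move: (V dv) (dis d.2) (dis d.2.+1).
  by rewrite {1 3}/dom_row dv; lia.
- by move=> i; rewrite nth_pmax E E'; have := dis i; lia.
move=> dv; rewrite !E; move: (V' dv) (dis d'.2) (dis d'.2.+1).
by rewrite {2 4}/dom_row dv; lia.
Qed.

(** With different top rows, a common row would be the lower row of a vertical domino and the top
    row of the other. Verticality makes the two rows of the first equal in [la], so the other domino
    would make the lower row longer than the one above it. *)
Lemma steps_overlap d d' la mu nu : step d la nu -> step d' la mu -> d <> d' ->
  d.2 = d'.2 \/ forall i, 0 < dom_row d i -> dom_row d' i = 0.
Proof.
move=> [_ pnu E V] [_ pmu E' V'] ne.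
case: (eqVneq d.2 d'.2) => [|ne2]; [by left | right => i].
have [onu _] := (is_partP nu).1 pnu; have [omu _] := (is_partP mu).1 pmu.
move: (onu d'.2) (omu d.2) (E d.2) (E d.2.+1) (E d'.2) (E d'.2.+1).
move: (E' d.2) (E' d.2.+1) (E' d'.2) (E' d'.2.+1) V V' ne2.
rewrite /dom_row; case: d d' {ne E E'} => [[] k] [[] k'] /=; move=> *;
  (have [?|?] := eqVneq k k'.+1; first (subst k; lia));
  (have [?|?] := eqVneq k' k.+1; first (subst k'; lia)); lia.
Qed.

(** The union enters as any [p] with the right row lengths, so that the lemma serves both orders of
    the arguments of [pmax]. *)
Lemma overlap_step k la nu mu p :
  step (false, k) la nu -> step (true, k) la mu -> is_part p ->
  (forall i, nth 0 p i = maxn (nth 0 nu i) (nth 0 mu i)) ->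
  let rho := add_cell p (k.+1, (nth 0 la k).+1) in
  step (true, k) mu rho /\ step (false, k.+1) nu rho.
Proof.
move=> [pla pnu E V] [_ pmu E' V'] pp Ep rho.
have [ord _] := (is_partP la).1 pla; have [onu _] := (is_partP nu).1 pnu.
have /= {V V'} eq_k := V' isT.
have Erho i : nth 0 rho i = nth 0 la i + (i == k).*2 + (i == k.+1).*2.
  rewrite nth_add_cell Ep E E' /dom_row /=.
  by have [->|] := eqVneq i k.+1; lia.
have prho: is_part rho.
  apply/is_partP; split=> i.
    have := onu i; have := ord i; rewrite !Erho !E /dom_row /=.
    have [->|] := eqVneq i k.+1; first by lia.
    by have [->|] := eqVneq i k; lia.
  apply/(all_nthP 0)/add_cell_pos => /=; last by have /andP[] := pp.
  rewrite ltnNge; apply/negP => /(nth_default 0).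
  by rewrite Ep E /dom_row /=; lia.
split; split=> //.
- by move=> i; rewrite Erho E' /dom_row /=; lia.
- by move=> _; rewrite !E' /dom_row /=; lia.
by move=> i; rewrite Erho E /dom_row /=; lia.
Qed.

Lemma rule4_grow d d' la mu nu : step d la nu -> step d' la mu ->
  grow None la mu nu (rule4 la mu nu).
Proof.
move=> st st'; rewrite /rule4 (step_skew st) (step_skew st').
have [pla pnu E V] := st; have [_ pmu E' V'] := st'.
have [ord _] := (is_partP la).1 pla.
case: eqP => [/dom_cells_inj Ed|ne].
  have Emu: mu = nu by apply: step_tgt_inj st; rewrite Ed.
  rewrite {}Emu in pmu E' st' *; subst d'.
  case: d E V st {st' V' E'} => b k /= E V st; case: b E V st => E V st /=.
    rewrite !eqxx /=.
    (* Row [c] is the first one not reaching past the column right of the domino. Row [k] does not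
       either, so [c <= k]; rows [c] and [c.+1] then lie between rows of [nu] that force their
       length to be exactly that column index. *)
    have := @col_lenP nu (nth 0 la k).+1 _ pnu.
    set c := col_len _ _ => c_nu.
    have Ek := E k; have Ek1 := E k.+1; rewrite /dom_row /= in Ek Ek1.
    have le_ck: c <= k by have := c_nu k; lia.
    have [lec lec1] := (part_le pnu le_ck, part_le pnu (leqW (leqnn c))).
    have le1 : nth 0 nu k.+1 <= nth 0 nu c.+1 by apply: (part_le pnu); lia.
    have nuc : nth 0 nu c = (nth 0 la k).+1 by have := c_nu c; lia.
    apply: (grow_vv (k := k) (c := c) st); last by lia.
    by apply: add_two_col_step; rewrite // -/c; have := V isT; lia.
  rewrite eqn_leq ltnn andbF /=; apply: (grow_hh st).
  apply: add_two_row_step => // _ /=; rewrite !E /dom_row /=.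
  by have := ord k; lia.
have dd: d <> d' by move=> Ed; rewrite Ed in ne.
have [E2|dis] := steps_overlap st st' dd; last first.
  have [? ?] := pmax_step st st' dis.
  rewrite (_ : [seq _ <- _ | _] = [::]); first exact: grow_comm st st' _ _.
  have rowP e c : c \in dom_cells e la -> 0 < dom_row e c.1.
    by rewrite !inE /dom_row; case: e.1 => /orP[] /eqP-> /=; lia.
  apply/eqP; rewrite -size_eq0 size_filter -leqn0 leqNgt -has_count.
  by apply/hasPn => c /rowP /dis c0; apply/negP => /rowP; rewrite c0.
(* Distinct dominoes with the same top row are one horizontal and one vertical, sharing exactly the
   first free cell of row [k]. *)
case: d d' E2 st st' dd {E V E' V' ne} => [b k] [b' k'] /= <- {k'} st st' dd.
have [ltk1 ltk2]: (k == k.+1) = false /\ (k.+1 == k) = false by lia.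
have [ltl1 ltl2]: (nth 0 la k == (nth 0 la k).+1) = false /\
  ((nth 0 la k).+1 == nth 0 la k) = false by lia.
case: b b' => [] [] // in dd st st' *;
  rewrite /dom_cells /= !inE !xpair_eqE !eqxx ?ltk1 ?ltk2 ?ltl1 ?ltl2 /=.
  have max_rows i : nth 0 (pmax nu mu) i = maxn (nth 0 mu i) (nth 0 nu i).
    by rewrite nth_pmax maxnC.
  have [? ?] := overlap_step st' st (pmax_part pnu pmu) max_rows.
  exact: (@grow_vh k).
have [? ?] := overlap_step st st' (pmax_part pnu pmu) (nth_pmax nu mu).
exact: (@grow_hv k).
Qed.

Lemma local_rule_grow m la mu nu :
  is_part la -> wstep la mu -> wstep la nu ->
  (m <> None -> la = mu /\ la = nu) ->
  grow m la mu nu (local_rule m la mu nu).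
Proof.
move=> pla st_mu st_nu; case: m => [b|_].
  case=> // <- <-; case: b => /=; last by apply/grow_plus/add_two_row_step.
  (* The height of column 0 is the number of rows, so the new vertical domino starts in the first
     empty row. *)
  have c0 i : 0 < nth 0 la i = (i < col_len la 0) by rewrite col_lenP.
  have z i : col_len la 0 <= i -> nth 0 la i = 0 by have := c0 i; lia.
  apply: (@grow_minus (col_len la 0)); last exact: z.
  by apply: add_two_col_step => //; apply: z.
rewrite /local_rule; case: eqP => [<-|ne_mu] /=.
  have le_nu : sumn la <= sumn nu.
    by case: st_nu => [<-//|[d /step_sumn->]]; apply: leq_addr.
  by rewrite /largest3 le_nu /= le_nu; apply: grow_left.
case: eqP => [<-|ne_nu].
  have lt_mu : sumn la < sumn mu.
    by case: st_mu => // -[d /step_sumn->]; rewrite -addn1 leq_add2l.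
  by rewrite /largest3 [sumn mu <= _]leqNgt lt_mu /= (ltnW lt_mu); apply: grow_top.
case: st_mu => // -[d' st'].
by case: st_nu => // -[d st]; apply: rule4_grow st st'.
Qed.

(** * Inverting the local rule *)

(** A vertical domino can be added to a given column only directly below it: starting lower, its top
    row would exceed the equally long row above. *)
Lemma vstep_tgt_row_inj c c' nu rho rho' :
  step (true, c) nu rho -> step (true, c') nu rho' ->
  nth 0 nu c = nth 0 nu c' -> c = c'.
Proof.
wlog lt_c: c c' rho rho' / c < c' => [thl st st' E|].
  by case: (ltngtP c c') => // lt_c; [apply: thl st st' _ | apply/esym/(thl _ _ _ _ lt_c st' st)].
move=> [pnu _ _ _] [_ prho' E' _] E.
case: c' lt_c E' E => // c' le_c E' E.
have := part_le pnu (le_c : c <= c'); have := part_le prho' (leqnSn c').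
by rewrite !E' E /dom_row /=; lia.
Qed.

(** Dually, a vertical domino can be removed from a given column only at its bottom; removed higher
    up, it would leave a row shorter than the one below. *)
Lemma vstep_src_row_inj k k' la la' nu :
  step (true, k) la nu -> step (true, k') la' nu ->
  nth 0 nu k = nth 0 nu k' -> k = k'.
Proof.
wlog lt_k: k k' la la' / k < k' => [thl st st' E|].
  by case: (ltngtP k k') => // lt_k; [apply: thl st st' _ | apply/esym/(thl _ _ _ _ lt_k st' st)].
move=> [pla pnu E V] [_ _ E' V'] Ek.
have := part_le pla (leqnSn k.+1); have := part_le pnu (lt_k : k.+2 <= k'.+1).
move: Ek (V isT) (V' isT) (E' k') (E' k'.+1) (E k) (E k.+2).
by rewrite /dom_row /=; lia.
Qed.

(** Separates [grow_comm] from the overlapping patterns: the horizontal domino makes rows [k] and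
    [k.+1] unequal, so no vertical one fits there. *)
Lemma overlap_comm_false k la mu nu rho :
  step (true, k) la nu -> step (false, k) la mu -> step (true, k) mu rho -> False.
Proof.
move=> [_ _ _ V] [_ _ E' _] [_ _ _ V''].
by move: (V isT) (V'' isT) (E' k) (E' k.+1); rewrite /dom_row /=; lia.
Qed.

(** The same separation in the backward direction: rows [k] and [k.+1] of [la] are equal, leaving no
    room in row [k.+1]. *)
Lemma vh_conflict k la mu nu :
  step (true, k) la nu -> step (false, k.+1) la mu -> False.
Proof.
move=> [_ _ _ V] [_ pmu E _]; have := part_le pmu (leqnSn k).
by move: (V isT); rewrite !E /dom_row /=; lia.
Qed.

(** Separates [grow_vv] from [grow_minus]: a column right of a domino is not column 0. *)
Lemma vstep_row_pos c k la nu :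
  step (true, k) la nu -> nth 0 nu c = nth 0 nu k -> nth 0 nu c = 0 -> False.
Proof. by move=> [_ _ E _] ->; rewrite E /dom_row /=; lia. Qed.

(** Identifies the labels of any two steps between the same partitions, closing the goal when they
    disagree. The [tryif] guard keeps it from looping on labels already equal. *)
Ltac step_cleanup :=
  repeat match goal with
  | H : wstep _ _ |- _ => case: H => [?|[? ?]]; subst
  | H : step _ ?a ?a |- _ => by case: (step_irr H)
  | H : ?d <> ?d |- _ => by case: H
  | H : (_, _) = (_, _) |- _ => by []
  | H : (_, _) = (_, _) |- _ => case: H => *; subst
  | H : step ?d ?a ?b, H' : step ?d' ?a ?b |- _ =>
      tryif constr_eq d d' then fail else
      (have := step_inj H H'; let E := fresh in move=> E;
       first [ by [] | progress subst | case: E => *; subst ])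
  end.

Lemma grow_rho_inj m la mu nu rho rho' :
  grow m la mu nu rho -> grow m la mu nu rho' -> rho = rho'.
Proof.
case=> {m la mu nu rho}.
all: intros; match goal with H : grow _ _ _ _ _ |- _ => inversion H; subst end.
all: step_cleanup.
all: try by [].
all: try (by eapply step_tgt_inj; eassumption).
all: try match goal with
  H : step (true, ?k) ?la ?nu, H' : step (false, ?k) ?la ?mu, H'' : step (true, ?k) ?mu _ |- _ =>
    by case: (overlap_comm_false H H' H'') end.
(* What remains is [grow_vv] or [grow_minus] against itself, where the position of the new domino is
   known only through its column. *)
- match goal with H : step (true, ?a) ?nu ?rho, H' : step (true, ?b) ?nu ?rho' |- ?rho = ?rho' =>
    have Ec : a = b by apply: (vstep_tgt_row_inj H H'); congruence end.
  by subst; eapply step_tgt_inj; eassumption.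
- match goal with H : step (true, ?a) ?nu ?rho, H' : step (true, ?b) ?nu ?rho' |- ?rho = ?rho' =>
    have Ec : a = b by apply: (vstep_tgt_row_inj H H'); congruence end.
  by subst; eapply step_tgt_inj; eassumption.
Qed.

Lemma grow_la_inj m m' la la' mu nu rho :
  grow m la mu nu rho -> grow m' la' mu nu rho -> m = m' /\ la = la'.
Proof.
case=> {m la mu nu rho}.
all: intros; match goal with H : grow _ _ _ _ _ |- _ => inversion H; subst end.
all: step_cleanup.
all: try by [].
all: try (by split=> //; eapply step_src_inj; eassumption).
all: try match goal with
  H : step (true, ?k) ?la _, H' : step (false, ?k.+1) ?la _ |- _ =>
    by case: (vh_conflict H H') end.
all: try match goal with
  H : step (true, ?k) _ ?nu, H' : nth 0 ?nu ?c = nth 0 ?nu ?k, H'' : nth 0 ?nu ?c = 0 |- _ =>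
    by case: (vstep_row_pos H H' H'') end.
(* What remains is [grow_vv] against itself: the column of the removed domino is known, and its row
   follows. *)
match goal with H : step (true, ?a) ?la ?nu, H' : step (true, ?b) ?la' ?nu |- _ /\ ?la = ?la' =>
  have Ek : a = b by apply: (vstep_src_row_inj H H'); congruence end.
subst; split=> //; match goal with
  H : step ?d ?la ?nu, H' : step ?d ?la' ?nu |- ?la = ?la' => exact: step_src_inj H H' end.
Qed.

(** Dominoes removable from [rho] that meet a common row share the last cell of that row. If they
    are distinct, [mu] and [nu] being partitions leaves one configuration: a vertical domino and a
    horizontal one in its lower row. *)
Lemma costeps_overlap d d' mu nu rho :
  step d mu rho -> step d' nu rho -> d <> d' ->
  [\/ forall i, 0 < dom_row d i -> dom_row d' i = 0,
      exists k, d = (true, k) /\ d' = (false, k.+1)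
    | exists k, d = (false, k.+1) /\ d' = (true, k)].
Proof.
move=> [pmu _ E V] [pnu _ E' V'].
have [omu _] := (is_partP mu).1 pmu; have [onu _] := (is_partP nu).1 pnu.
move: (omu d'.2) (omu d'.2.+1) (onu d.2) (onu d.2.+1) V V'.
move: (E d.2) (E d.2.+1) (E d.2.+2) (E d'.2) (E d'.2.+1) (E d'.2.+2).
move: (E' d.2) (E' d.2.+1) (E' d.2.+2) (E' d'.2) (E' d'.2.+1) (E' d'.2.+2).
rewrite /dom_row; case: d d' {E E'} => [[] k] [[] k'] /= + + + + + + + + + + + + + + + + + + ne.
- have nek: k <> k' by move=> E; rewrite E in ne.
  have [?|?] := eqVneq k k'.+1; first by subst k; lia.
  have [?|?] := eqVneq k' k.+1; first by subst k'; lia.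
  by constructor 1; lia.
- have [->|?] := eqVneq k' k.+1; first by constructor 2; exists k.
  have [?|?] := eqVneq k' k; first by subst k'; lia.
  by constructor 1; lia.
- have [->|?] := eqVneq k k'.+1; first by constructor 3; exists k'.
  have [?|?] := eqVneq k k'; first by subst k'; lia.
  by constructor 1; lia.
have nek: k <> k' by move=> E; rewrite E in ne.
by constructor 1; lia.
Qed.

Lemma grow_exists_comm d d' mu nu rho :
  step d mu rho -> step d' nu rho -> d <> d' ->
  (forall i, 0 < dom_row d i -> dom_row d' i = 0) ->
  exists la, grow None la mu nu rho.
Proof.
move=> st st' ne dis; have [pmu _ E V] := st; have [pnu _ E' V'] := st'.
have [omu _] := (is_partP mu).1 pmu; have [onu _] := (is_partP nu).1 pnu.
have [||la [pla Ela]] := @part_of_fun (fun i => minn (nth 0 mu i) (nth 0 nu i)) (size mu).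
- by move=> i; have := omu i; have := onu i; lia.
- by rewrite nth_default ?min0n.
exists la; apply: (grow_comm ne _ _ st st'); split=> //.
- by move=> i; rewrite Ela; have := dis i; have := E i; have := E' i; lia.
- move=> dv; rewrite !Ela; move: (V dv) (dis d.2) (dis d.2.+1) (E d.2) (E d.2.+1) (E' d.2) (E' d.2.+1).
  by rewrite {1 3 5 6}/dom_row dv; lia.
- by move=> i; rewrite Ela; have := dis i; have := E i; have := E' i; lia.
move=> dv; rewrite !Ela; move: (V' dv) (dis d'.2) (dis d'.2.+1) (E d'.2) (E d'.2.+1) (E' d'.2) (E' d'.2.+1).
by rewrite {2 4 7 8}/dom_row dv; lia.
Qed.

Lemma grow_exists_hv k mu nu rho :
  step (true, k) mu rho -> step (false, k.+1) nu rho ->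
  exists la, grow None la mu nu rho.
Proof.
move=> st st'; have [pmu _ E V] := st; have [pnu _ E' _] := st'.
have [omu _] := (is_partP mu).1 pmu; have [onu _] := (is_partP nu).1 pnu.
have /= Vk := V isT.
(* This removes from [rho] a two by two square. Row [k.+2] is short enough because [nu], whose row
   [k.+1] already lacks two cells of [rho], is a partition. *)
pose g i := nth 0 mu i - (i == k) - (i == k.+1).
have gt1 : nth 0 mu k.+2 < nth 0 mu k.+1.
  move: (E k.+1) (E k.+2) (E' k.+1) (E' k.+2) (onu k.+1); rewrite /dom_row /=; lia.
have [||la [pla Ela]] := @part_of_fun g (size mu).
- move=> i; have := omu i; rewrite /g.
  have [->|] := eqVneq i k.+1; first by lia.
  by have [->|] := eqVneq i k; lia.
- by rewrite /g nth_default.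
exists la; apply: (@grow_hv k) => //; split=> //.
- move=> i; move: (E i) (E' i); rewrite Ela /g /dom_row /=.
  have [->|] := eqVneq i k.+1; first by lia.
  by have [->|] := eqVneq i k; lia.
- move=> i; rewrite Ela /g /dom_row /=.
  have [->|] := eqVneq i k.+1; first by lia.
  by have [->|] := eqVneq i k; lia.
by move=> _; rewrite /= !Ela /g; lia.
Qed.

(** A horizontal domino is moved up to the end of the previous row, a vertical one left to the
    bottom of the previous column; when there is no previous row or column, the matrix entry is
    nonzero. *)
Lemma grow_exists_same d nu rho : step d nu rho ->
  exists m la, grow m la nu nu rho.
Proof.
move=> st; have [pnu _ E V] := st; have [onu _] := (is_partP nu).1 pnu.
case: d st E V => [[] c] st E V.
  have [nuc|nuc] := posnP (nth 0 nu c).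
    by exists (Some true), nu; apply: (@grow_minus c).
  have /= Vc := V isT.
  (* [p] is the height of the column just left of the added domino. It exceeds [c.+1], since rows
     [c] and [c.+1] reach that column, so its two bottom cells, in rows [p.-2] and [p.-1], can be
     removed. *)
  have := @col_lenP nu (nth 0 nu c).-1 _ pnu; set p := col_len _ _ => pP.
  have lt_p : c.+1 < p by rewrite pP; lia.
  pose k := p.-2; pose g i := nth 0 nu i - (i == k) - (i == k.+1).
  have nuk : nth 0 nu k = nth 0 nu c.
    by have := part_le pnu (_ : c <= k); have := pP k; rewrite /k; lia.
  have nuk1 : nth 0 nu k.+1 = nth 0 nu c.
    by have := part_le pnu (_ : c <= k.+1); have := pP k.+1; rewrite /k; lia.
  have nuk2 : nth 0 nu k.+2 < nth 0 nu c by have := pP k.+2; rewrite /k; lia.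
  have [||la [pla Ela]] := @part_of_fun g (size nu).
  - move=> i; have := onu i; rewrite /g.
    have [->|] := eqVneq i k.+1; first by lia.
    by have [->|] := eqVneq i k; lia.
  - by rewrite /g nth_default.
  exists None, la; apply: (grow_vv (k := k) _ st) => //; split=> // [i|_].
    rewrite Ela /g /dom_row /=.
    have [->|] := eqVneq i k.+1; first by lia.
    by have [->|] := eqVneq i k; lia.
  by rewrite /= !Ela /g; lia.
case: c st E V => [|k] st E V; first by exists (Some false), nu; apply: grow_plus.
have [orho _] := (is_partP rho).1 (step_tgt st).
(* Two cells fit in row [k.+1] below row [k], hence two cells can be removed from row [k]. *)
have le2 : nth 0 nu k.+1 + 2 <= nth 0 nu k.
  by move: (orho k); rewrite !E /dom_row /=; lia.
pose g i := nth 0 nu i - (i == k).*2.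
have [||la [pla Ela]] := @part_of_fun g (size nu).
- by move=> i; have := onu i; rewrite /g; have [->|] := eqVneq i k; lia.
- by rewrite /g nth_default.
exists None, la; apply: (grow_hh (k := k) _ st); split=> // i.
by rewrite Ela /g /dom_row /=; have [->|] := eqVneq i k; lia.
Qed.

Lemma grow_exists mu nu rho : wstep mu rho -> wstep nu rho ->
  exists m la, grow m la mu nu rho.
Proof.
case=> [->|[d st]] st_nu; first by exists None, nu; apply: grow_top.
case: st_nu => [->|[d' st']].
  by exists None, mu; apply: grow_left; right; exists d.
have [Ed|/eqP ne] := eqVneq d d'.
  by rewrite -Ed in st'; rewrite (step_src_inj st st'); apply: grow_exists_same st'.
case: (costeps_overlap st st' ne) => [dis|[k [Ed Ed']]|[k [Ed Ed']]].
- by have [la ?] := grow_exists_comm st st' ne dis; exists None, la.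
- by subst; have [la ?] := grow_exists_hv st st'; exists None, la.
subst; have [la ?] := grow_exists_hv st' st.
by exists None, la; apply: grow_sym.
Qed.

Lemma grow_valid m la mu nu rho : grow m la mu nu rho -> is_part rho ->
  [/\ is_part la, wstep la mu, wstep la nu & m <> None -> la = mu /\ la = nu]
  /\ wstep mu rho /\ wstep nu rho.
Proof.
have eqw x : wstep x x by left.
have stw d x y : step d x y -> wstep x y by right; exists d.
have src x y : wstep x y -> is_part y -> is_part x by case=> [->|[d []]].
case=> {m la mu nu rho}.
- by move=> la nu st pr; do !split=> //; apply: src st pr.
- by move=> la mu st pr; do !split=> //; apply: src st pr.
- by move=> d d' la mu nu rho _ s1 s2 s3 s4 _; do !split=> //; eauto; case: s1.
- by move=> k la mu nu rho s1 s2 s3 s4 _; do !split=> //; eauto; case: s1.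
- by move=> k la mu nu rho s1 s2 s3 s4 _; do !split=> //; eauto; case: s1.
- by move=> k la nu rho s1 s2 _; do !split=> //; eauto; case: s1.
- by move=> k c la nu rho s1 s2 _ _; do !split=> //; eauto; case: s1.
- by move=> la rho s1 _; do !split=> //; eauto; case: s1.
by move=> c la rho s1 _ _; do !split=> //; eauto; case: s1.
Qed.

Definition vdom (la mu : part) : nat := is_vdomino (skew mu la).

(** A zero entry either carries each orientation to the opposite edge or, in [grow_hv] and
    [grow_vh], swaps a vertical with a horizontal one; [grow_minus] alone creates two vertical edges
    from none. *)
Lemma grow_vdom m la mu nu rho : grow m la mu nu rho ->
  vdom nu rho + vdom mu rho = vdom la nu + vdom la mu + (m == Some true).*2.
Proof.
have vv x : vdom x x = 0 by rewrite /vdom skew_id.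
have vs d x y : step d x y -> vdom x y = d.1.
  by rewrite /vdom => /vdom_step->.
case=> {m la mu nu rho}; intros; rewrite ?vv.
all: repeat match goal with H : step _ ?x ?y |- _ => rewrite ?(vs _ _ _ H); clear H end.
all: rewrite /=; lia.
Qed.

(** * The growth diagram of a word *)

Lemma nth_delta r i : nth 0 (delta r) i = r - i.
Proof.
rewrite /delta; case: (ltnP i r) => [lt_i|le_i].
  by rewrite nth_rev size_iota // nth_iota; lia.
by rewrite nth_default ?size_rev ?size_iota //; lia.
Qed.

Lemma delta_part r : is_part (delta r).
Proof.
apply/is_partP; split=> i; rewrite !nth_delta; first by lia.
by rewrite size_rev size_iota; lia.
Qed.

(** Consecutive rows of a staircase drop by one until they vanish: removing a horizontal domino
    needs a drop of two, a vertical one two equal nonempty rows. *)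
Lemma delta_no_step r d mu : ~ step d mu (delta r).
Proof.
move=> [pmu _ E V]; have [omu _] := (is_partP mu).1 pmu.
case: d E V => [[] k] E V; move: (E k) (E k.+1) (omu k); rewrite !nth_delta /dom_row /=.
  by move: (V isT) => /=; lia.
by lia.
Qed.

Lemma delta_no_removable r : no_removable_domino (delta r).
Proof. by move=> mu; apply/negP => /dstepP[d] /delta_no_step. Qed.

Definition grid r w i j : part := nth [::] (growth_row r w i) j.

Lemma size_next_row_aux w i j mu prev :
  size (next_row_aux w i j mu prev) = (size prev).-1.
Proof.
by elim: prev j mu => [|la [|nu rest] IH] j mu //=; rewrite IH.
Qed.

Lemma nth_next_row_aux w i j mu prev k : k.+1 < size prev ->
  nth [::] (next_row_aux w i j mu prev) k
  = local_rule (Mentry w i (j + k)) (nth [::] prev k)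
      (nth [::] (mu :: next_row_aux w i j mu prev) k) (nth [::] prev k.+1).
Proof.
elim: prev j mu k => [|la [|nu rest] IH] j mu k //=.
case: k => [|k] lt_k; first by rewrite addn0.
by have := IH j.+1 (local_rule (Mentry w i j) la mu nu) k lt_k; rewrite addSnnS; apply.
Qed.

Lemma size_growth_row r w i : size (growth_row r w i) = (size w).+1.
Proof.
by elim: i => [|i IHi] /=; rewrite ?size_nseq // size_next_row_aux IHi.
Qed.

Lemma grid_top r w j : j <= size w -> grid r w 0 j = delta r.
Proof. by move=> le_j; rewrite /grid nth_nseq ltnS le_j. Qed.

Lemma grid_left r w i : grid r w i 0 = delta r.
Proof. by case: i => [|i] //; rewrite grid_top. Qed.

Lemma gridS r w i j : j < size w ->
  grid r w i.+1 j.+1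
  = local_rule (Mentry w i j) (grid r w i j) (grid r w i.+1 j) (grid r w i j.+1).
Proof.
by move=> lt_j; rewrite /grid /= nth_next_row_aux ?add0n // size_growth_row.
Qed.

Lemma Pd_grid r w : Pd r w = mkseq (grid r w (size w)) (size w).+1.
Proof.
apply: (@eq_from_nth _ [::]); first by rewrite size_mkseq size_growth_row.
by move=> j; rewrite size_growth_row => lt_j; rewrite nth_mkseq.
Qed.

Lemma Qd_grid r w : Qd r w = mkseq (fun i => grid r w i (size w)) (size w).+1.
Proof.
(* Rows are nonempty, so the differing defaults of [last] and [nth] never appear. *)
apply: eq_map => i; rewrite /grid -[size w]/((size w).+1.-1).
rewrite -(size_growth_row r w i) nth_last.
by case: (growth_row r w i) (size_growth_row r w i).
Qed.

Definition edge (e : bool) (la mu : part) : Prop :=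
  if e then exists d, step d la mu else la = mu.

Lemma edge_wstep e la mu : edge e la mu -> wstep la mu.
Proof. by case: e; [right | left]. Qed.

Lemma edge_refl e la : edge e la la -> e = false.
Proof. by case: e => // -[d /step_irr]. Qed.

Lemma edge_step e d la mu : edge e la mu -> step d la mu -> e.
Proof. by case: e => //= -> /step_irr. Qed.

(** The flags tell whether an edge adds a domino. A zero entry copies each flag to the opposite
    edge, and a nonzero entry flips both. *)
Lemma grow_edge m la mu nu rho e f : grow m la mu nu rho ->
  edge e la mu -> edge f la nu ->
  edge (e (+) isSome m) nu rho /\ edge (f (+) isSome m) mu rho.
Proof.
case=> {m la mu nu rho} /=.
- by move=> la nu _ /edge_refl-> ef; rewrite /= ?addbF; split.
- by move=> la mu _ ee /edge_refl->; rewrite /= ?addbF; split.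
- by move=> d d' la mu nu rho _ s1 s2 s3 s4 /edge_step/(_ s2)-> /edge_step/(_ s1)->;
    split; [exists d' | exists d].
- by move=> k la mu nu rho s1 s2 s3 s4 /edge_step/(_ s2)-> /edge_step/(_ s1)->;
    split; [exists (false, k.+1) | exists (true, k)].
- by move=> k la mu nu rho s1 s2 s3 s4 /edge_step/(_ s2)-> /edge_step/(_ s1)->;
    split; [exists (true, k) | exists (false, k.+1)].
- by move=> k la nu rho s1 s2 /edge_step/(_ s1)-> /edge_step/(_ s1)->;
    split; exists (false, k.+1).
- by move=> k c la nu rho s1 s2 _ /edge_step/(_ s1)-> /edge_step/(_ s1)->;
    split; exists (true, c).
- by move=> la rho s1 /edge_refl-> /edge_refl->; split; exists (false, 0).
by move=> c la rho s1 _ /edge_refl-> /edge_refl->; split; exists (true, c).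
Qed.

Section Forward.
Variables (r n : nat) (w : sword).
Hypothesis wB : in_Bn n w.
Let letter i := (nth (0, false) w i).1.

Lemma Bn_size : size w = n. Proof. by case: wB. Qed.

Lemma letter_bounds i : i < n -> 0 < letter i <= n.
Proof.
move=> lt_i; have [sz /perm_mem/(_ (letter i))] := wB.
rewrite mem_iota addnC addn1 ltnS => <-.
by rewrite /letter -(nth_map _ 0) ?sz // mem_nth // size_map sz.
Qed.

Lemma letters_uniq : uniq (map fst w).
Proof. by have [_ /perm_uniq->] := wB; apply: iota_uniq. Qed.

Lemma letterE i : i < n -> letter i = nth 0 (map fst w) i.
Proof. by move=> lt_i; rewrite (nth_map (0, false)) // Bn_size. Qed.

Lemma isSome_Mentry i j : isSome (Mentry w i j) = (letter i == j.+1).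
Proof. by rewrite /Mentry /letter; case: eqP. Qed.

(** The exclusive or is correct because letters are distinct: letter [i] is absent from the earlier
    ones. It mirrors the flag rule of [grow_edge]. *)
Lemma mem_take_letter i j : i < n ->
  (j.+1 \in take i.+1 (map fst w))
  = (j.+1 \in take i (map fst w)) (+) (letter i == j.+1).
Proof.
move=> lt_i; have lt_i' : i < size (map fst w) by rewrite size_map Bn_size.
rewrite (take_nth 0 lt_i') mem_rcons inE -letterE // [j.+1 == _]eq_sym.
case: eqP => [<-|] /=; last by rewrite addbF.
have : uniq (take i.+1 (map fst w)) by apply: subseq_uniq letters_uniq; apply: take_subseq.
by rewrite (take_nth 0 lt_i') rcons_uniq -letterE // => /andP[/negPf->].
Qed.

(** One row of squares, by induction on the column: the edge down from row [i] adds a domino exactly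
    from column [letter i] on, while the edges along row [i] are known from the letters already
    read. *)
Lemma grid_edge_row i : i < n ->
  (forall j, j <= n -> is_part (grid r w i j)) ->
  (forall j, j < n -> edge (j.+1 \in take i (map fst w)) (grid r w i j) (grid r w i j.+1)) ->
  forall j, j <= n ->
    edge (letter i <= j) (grid r w i j) (grid r w i.+1 j) /\
    (j < n -> grow (Mentry w i j) (grid r w i j) (grid r w i.+1 j)
                (grid r w i j.+1) (grid r w i.+1 j.+1)).
Proof.
move=> lt_i pG eG.
have grow_at j : j < n -> edge (letter i <= j) (grid r w i j) (grid r w i.+1 j) ->
    grow (Mentry w i j) (grid r w i j) (grid r w i.+1 j)
         (grid r w i j.+1) (grid r w i.+1 j.+1).
  move=> lt_j ev; rewrite (@gridS r w i j) ?Bn_size //.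
  apply: local_rule_grow; [exact: pG (ltnW lt_j) | exact: edge_wstep ev | exact: edge_wstep (eG j lt_j) |].
  (* At a nonzero entry the letter [j.+1] is read for the first time, so both edges out of the
     corner are constant. *)
  move=> m_some; have /eqP Ej : letter i == j.+1.
    by rewrite -isSome_Mentry; case: Mentry m_some.
  move: ev (eG j lt_j) (mem_take_letter j lt_i); rewrite Ej ltnn eqxx.
  rewrite addbT => /= -> eh /esym/negbRL.
  have -> : j.+1 \in take i.+1 (map fst w).
    by rewrite (take_nth 0) ?size_map ?Bn_size // mem_rcons -letterE // Ej mem_head.
  by move=> Eh; rewrite Eh in eh.
elim=> [|j IHj] le_j; last first.
  have [ev /(_ le_j) gr] := IHj (ltnW le_j).
  have [e1 _] := grow_edge gr ev (eG j le_j).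
  suff e2: edge (letter i <= j.+1) (grid r w i j.+1) (grid r w i.+1 j.+1).
    by split=> // lt_j; apply: grow_at.
  move: e1; rewrite isSome_Mentry [letter i <= j.+1]leq_eqVlt ltnS.
  by case: eqP => [->|_]; rewrite ?ltnn ?addbF.
suff e0: edge (letter i <= 0) (grid r w i 0) (grid r w i.+1 0).
  by split=> // lt_0; apply: grow_at.
by rewrite !grid_left leqNgt; case/andP: (letter_bounds lt_i) => ->.
Qed.

Lemma grid_rows i : i <= n ->
  (forall j, j <= n -> is_part (grid r w i j)) /\
  (forall j, j < n -> edge (j.+1 \in take i (map fst w)) (grid r w i j) (grid r w i j.+1)).
Proof.
elim: i => [|i IHi] lt_i.
  split=> j lt_j; first by rewrite grid_top ?Bn_size ?delta_part.
  by rewrite take0 /= !grid_top ?Bn_size // ltnW.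
have [pG eG] := IHi (ltnW lt_i).
have row := grid_edge_row lt_i pG eG.
split=> [j le_j|j lt_j].
  have [ev _] := row j le_j.
  case: (letter i <= j) ev => [[d []] //|/= <-]; exact: pG.
have [ev /(_ lt_j) gr] := row j (ltnW lt_j).
have [_] := grow_edge gr ev (eG j lt_j).
by rewrite isSome_Mentry -mem_take_letter.
Qed.

Lemma grid_grow i j : i < n -> j < n ->
  grow (Mentry w i j) (grid r w i j) (grid r w i.+1 j)
       (grid r w i j.+1) (grid r w i.+1 j.+1).
Proof.
move=> lt_i lt_j; have [pG eG] := grid_rows (ltnW lt_i).
by have [_ /(_ lt_j)] := grid_edge_row lt_i pG eG (ltnW lt_j).
Qed.

Lemma grid_last_row j : j < n -> exists d, step d (grid r w n j) (grid r w n j.+1).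
Proof.
move=> lt_j; have [_ /(_ j lt_j)] := grid_rows (leqnn n).
have [sz /perm_mem E] := wB.
(* After all letters are read, every edge of the row adds a domino. *)
by rewrite take_oversize ?size_map ?sz // E mem_iota add1n !ltnS lt_j.
Qed.

Lemma grid_last_col i : i < n -> exists d, step d (grid r w i n) (grid r w i.+1 n).
Proof.
move=> lt_i; have [pG eG] := grid_rows (ltnW lt_i).
have [+ _] := grid_edge_row lt_i pG eG (leqnn n).
by have /andP[_ ->] := letter_bounds lt_i.
Qed.

End Forward.

(** * Rebuilding the diagram from its border *)

Lemma wstep_neq_edge la mu : wstep la mu -> edge (la != mu) la mu.
Proof.
case=> [->|[d st]]; first by rewrite eqxx.
by case: eqP st => [-> /step_irr //|_ st]; exists d.
Qed.

Lemma edge_neq e la mu : edge e la mu -> e = (la != mu).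
Proof.
by case: e => [[d st]|->]; rewrite ?eqxx //; case: eqP st => // -> /step_irr.
Qed.

Lemma part_wstep la mu : wstep la mu -> is_part mu -> is_part la.
Proof. by case=> [->|[d []]]. Qed.

(** From the lower row and the upper right corner, [grow_exists] fills the squares from right to
    left; the induction peels off the last column. *)
Lemma row_back n (lo : nat -> part) q :
  (forall j, j <= n -> is_part (lo j)) -> (forall j, j < n -> wstep (lo j) (lo j.+1)) ->
  wstep q (lo n) ->
  exists (up : nat -> part) (m : nat -> option bool),
    [/\ up n = q, forall j, j <= n -> wstep (up j) (lo j)
      & forall j, j < n -> grow (m j) (up j) (lo j) (up j.+1) (lo j.+1)].
Proof.
elim: n q => [|n IHn] q plo slo st_q.
  exists (fun=> q), (fun=> None); split=> // j.
  by rewrite leqn0 => /eqP->.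
have [m0 [la gr]] := grow_exists (slo n (ltnSn n)) st_q.
have [[_ st_la _ _] _] := grow_valid gr (plo _ (leqnn _)).
have [|j lt_j|up [m [up_n st_up gr_up]]] := IHn la _ _ st_la.
- by move=> j le_j; apply/plo/leqW.
- exact/slo/leqW.
exists (fun j => if j == n.+1 then q else up j).
exists (fun j => if j == n then m0 else m j).
split=> [|j|j]; rewrite ?eqxx //.
  by case: eqP => [-> //|/eqP ne_j le_j]; apply: st_up; rewrite -ltnS ltn_neqAle ne_j.
rewrite ltnS eqSS => le_j; rewrite [j == n.+1]ltn_eqF //.
case: eqP => [->|/eqP ne_j]; first by rewrite up_n.
by apply: gr_up; rewrite ltn_neqAle ne_j.
Qed.

(** Iterates [row_back] upwards, with the right column [Q] supplying the corner of each row. *)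
Lemma grid_back N n (lo Q : nat -> part) :
  (forall j, j <= n -> is_part (lo j)) -> (forall j, j < n -> wstep (lo j) (lo j.+1)) ->
  Q N = lo n -> (forall i, i < N -> wstep (Q i) (Q i.+1)) ->
  exists (G : nat -> nat -> part) (M : nat -> nat -> option bool),
    [/\ forall j, j <= n -> G N j = lo j, forall i, i <= N -> G i n = Q i,
        forall i j, i <= N -> j <= n -> is_part (G i j),
        forall i j, i < N -> j <= n -> wstep (G i j) (G i.+1 j)
      & forall i j, i < N -> j < n ->
          grow (M i j) (G i j) (G i.+1 j) (G i j.+1) (G i.+1 j.+1)].
Proof.
elim: N lo => [|N IHN] lo plo slo QN sQ.
  exists (fun=> lo), (fun _ _ => None); split=> // [i|i j _].
    by rewrite leqn0 => /eqP->.
  exact: plo.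
have := sQ N (ltnSn N); rewrite QN => /(row_back plo slo)[up [m [up_n st_up gr_up]]].
have pup j (le_j : j <= n) : is_part (up j).
  exact: part_wstep (st_up j le_j) (plo j le_j).
have sup j : j < n -> wstep (up j) (up j.+1).
  by move=> lt_j; have [[]] := grow_valid (gr_up j lt_j) (plo _ lt_j).
have [|i lt_i|G [M [G_N G_n pG vG gG]]] := IHN up pup sup.
- by rewrite up_n.
- exact/sQ/leqW.
exists (fun i j => if i == N.+1 then lo j else G i j).
exists (fun i j => if i == N then m j else M i j).
split=> [j|i|i j|i j|i j]; rewrite ?eqxx //.
- by case: eqP => [->|/eqP ne_i le_i] //; apply: G_n; rewrite -ltnS ltn_neqAle ne_i.
- by case: eqP => [_ _|/eqP ne_i le_i]; [apply: plo | apply: pG; rewrite -ltnS ltn_neqAle ne_i].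
- rewrite ltnS eqSS => le_i le_j; rewrite [i == N.+1]ltn_eqF //.
  case: eqP => [->|/eqP ne_i]; first by rewrite G_N //; apply: st_up.
  by apply: vG; rewrite // ltn_neqAle ne_i.
rewrite ltnS eqSS => le_i lt_j; rewrite [i == N.+1]ltn_eqF //.
case: eqP => [->|/eqP ne_i]; first by rewrite !G_N ?(ltnW lt_j) //; apply: gr_up.
by apply: gG; rewrite // ltn_neqAle ne_i.
Qed.

(** No domino can be removed from a staircase, so constancy propagates backwards from the last
    entry. *)
Lemma wstep_delta r (f : nat -> part) n :
  (forall k, k < n -> wstep (f k) (f k.+1)) -> f n = delta r ->
  forall k, k <= n -> f k = delta r.
Proof.
elim: n => [|n IHn] st f_n k; first by rewrite leqn0 => /eqP->.
rewrite leq_eqVlt ltnS => /predU1P[-> //|]; apply: IHn => [i lt_i|].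
  exact/st/leqW.
by have := st n (ltnSn n); rewrite f_n => -[|[d /delta_no_step]].
Qed.

(** [s] toggles the switch [v] and acts only when it is off. Hence the switch is turned on at most
    once, stays on, and was toggled if it ends on. *)
Lemma switch_once (v s : nat -> bool) n :
  (forall j, j < n -> v j.+1 = v j (+) s j) ->
  (forall j, j < n -> s j -> v j = false) -> v 0 = false ->
  (v n -> exists2 j, j < n & s j) /\
  (forall j j', j < n -> j' < n -> s j -> s j' -> j = j').
Proof.
move=> vS sv v0; split.
  elim: n vS sv => [|n IHn] vS sv; first by rewrite v0.
  rewrite vS //; case: (boolP (s n)) => [s_n _|_]; first by exists n.
  rewrite addbF => /IHn[j lt_j|j lt_j|j lt_j s_j]; [exact/vS/leqW | exact/sv/leqW |].
  by exists j => //; apply: leqW.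
have on j k : j < n -> s j -> j < k -> k < n -> v k.
  move=> lt_j s_j; elim: k => // k IHk; rewrite ltnS leq_eqVlt => /predU1P[<- _|lt_jk lt_k].
    by rewrite vS // s_j sv.
  have v_k := IHk lt_jk (ltnW lt_k); rewrite vS ?(ltnW lt_k) // v_k.
  by case: (boolP (s k)) => // /sv; rewrite v_k => /(_ (ltnW lt_k)).
move=> j j' lt_j lt_j' s_j s_j'; case: (ltngtP j j') => // lt.
  by have := on _ _ lt_j s_j lt lt_j'; rewrite sv.
by have := on _ _ lt_j' s_j' lt lt_j; rewrite sv.
Qed.

Lemma grid_unique r w (G : nat -> nat -> part) :
  (forall j, j <= size w -> G 0 j = delta r) ->
  (forall i, i <= size w -> G i 0 = delta r) ->
  (forall i j, i < size w -> j < size w -> G i.+1 j.+1 =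
     local_rule (Mentry w i j) (G i j) (G i.+1 j) (G i j.+1)) ->
  forall i j, i <= size w -> j <= size w -> grid r w i j = G i j.
Proof.
move=> top left rule; elim=> [|i IHi] j lt_i; first by move=> le_j; rewrite grid_top // top.
elim: j => [|j IHj] lt_j; first by rewrite grid_left left.
by rewrite gridS // rule // IHj ?IHi // ltnW.
Qed.

(** Letters start at 1 and columns at 0, hence [j.+1]. The default of [odflt] is harmless on rows
    with a nonzero entry. *)
Definition word_of n (M : nat -> nat -> option bool) : sword :=
  mkseq (fun i => let j := find (fun j => isSome (M i j)) (iota 0 n) in
                  (j.+1, odflt false (M i j))) n.

Lemma Mentry_word_of n M i :
  (exists2 j, j < n & isSome (M i j)) ->
  (forall j j', j < n -> j' < n -> isSome (M i j) -> isSome (M i j') -> j = j') ->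
  i < n ->
  exists2 j, j < n & isSome (M i j) /\ nth (0, false) (word_of n M) i = (j.+1, odflt false (M i j)).
Proof.
case=> j lt_j s_j uniq_j lt_i; pose s j := isSome (M i j).
have has_s : has s (iota 0 n) by apply/hasP; exists j; rewrite ?mem_iota.
have lt_f : find s (iota 0 n) < n by rewrite -[n in X in _ < X](size_iota 0) -has_find.
have s_f : s (find s (iota 0 n)) by have := nth_find 0 has_s; rewrite nth_iota ?add0n.
by exists (find s (iota 0 n)) => //; split=> //; rewrite nth_mkseq.
Qed.

Lemma grid_word r n (G : nat -> nat -> part) (M : nat -> nat -> option bool) :
  (forall i j, i <= n -> j <= n -> is_part (G i j)) ->
  (forall i j, i < n -> j <= n -> wstep (G i j) (G i.+1 j)) ->
  (forall i j, i < n -> j < n ->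
     grow (M i j) (G i j) (G i.+1 j) (G i j.+1) (G i.+1 j.+1)) ->
  G n 0 = delta r -> G 0 n = delta r ->
  (forall i, i < n -> G i n != G i.+1 n) ->
  exists w, in_Bn n w /\ forall i j, i <= n -> j <= n -> grid r w i j = G i j.
Proof.
move=> pG vG gG Gn0 G0n neG.
have valid i j (lt_i : i < n) (lt_j : j < n) := grow_valid (gG i j lt_i lt_j) (pG i.+1 j.+1 lt_i lt_j).
have left : forall i, i <= n -> G i 0 = delta r.
  by apply: wstep_delta => // i lt_i; apply: vG.
have top : forall j, j <= n -> G 0 j = delta r.
  apply: wstep_delta => // j lt_j.
  by have [[]] := valid 0 j (leq_trans (ltn0Sn j) lt_j) lt_j.
pose v i j := G i j != G i.+1 j; pose h i j := G i j != G i j.+1.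
have vh i j (lt_i : i < n) (lt_j : j < n) :
    v i j.+1 = v i j (+) isSome (M i j) /\ h i.+1 j = h i j (+) isSome (M i j).
  have [[_ st1 st2 _] _] := valid i j lt_i lt_j.
  have [e1 e2] := grow_edge (gG i j lt_i lt_j) (wstep_neq_edge st1) (wstep_neq_edge st2).
  by rewrite /v /h -(edge_neq e1) -(edge_neq e2).
have sM i j (lt_i : i < n) (lt_j : j < n) : isSome (M i j) -> v i j = false /\ h i j = false.
  have [[_ _ _ eq3] _] := valid i j lt_i lt_j.
  by case: (M i j) eq3 => // b eq3 _; rewrite /v /h; case: eq3 => // <- <-; rewrite eqxx.
(* Along a row the switch is off in column 0, where the diagram is constant, and on in the last
   column by [neG]. *)
have row i (lt_i : i < n) : (exists2 j, j < n & isSome (M i j)) /\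
    forall j j', j < n -> j' < n -> isSome (M i j) -> isSome (M i j') -> j = j'.
  have [||| ex un] := @switch_once (v i) (fun j => isSome (M i j)) n.
  - by move=> j lt_j; case: (vh i j lt_i lt_j).
  - by move=> j lt_j /(sM i j lt_i lt_j)[].
  - by rewrite /v !left ?eqxx // ltnW.
  by split=> //; apply/ex/neG.
(* At most one nonzero entry per column makes the letters distinct; being [n] letters between 1 and
   [n], they form a permutation. *)
have col j (lt_j : j < n) :
    forall i i', i < n -> i' < n -> isSome (M i j) -> isSome (M i' j) -> i = i'.
  have [||| _ //] := @switch_once (h^~ j) (fun i => isSome (M i j)) n.
  - by move=> i lt_i; case: (vh i j lt_i lt_j).
  - by move=> i lt_i /(sM i j lt_i lt_j)[].
  - by rewrite /h !top ?eqxx // ltnW.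
pose w := word_of n M; exists w.
have sz_w : size w = n by rewrite size_mkseq.
have wP i (lt_i : i < n) := Mentry_word_of (row i lt_i).1 (row i lt_i).2 lt_i.
have Mw i j : i < n -> j < n -> Mentry w i j = M i j.
  move=> lt_i lt_j; rewrite /Mentry; have [j' lt_j' [s_j' ->]] := wP i lt_i.
  rewrite eqSS; case: eqP => [<-|ne_j] /=; first by case: (M i j') s_j'.
  case EM: (M i j) => [b|] //; case: ne_j.
  by apply: (row i lt_i).2; rewrite ?EM.
split; last first.
  have := @grid_unique r w G; rewrite sz_w; apply=> // i j lt_i lt_j.
  have [[pla st1 st2 eqs] _] := valid i j lt_i lt_j.
  by rewrite Mw //; apply: grow_rho_inj (gG i j lt_i lt_j) (local_rule_grow pla st1 st2 eqs).
have uniq_w : uniq (map fst w).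
  apply/(uniqP 0) => i i'; rewrite !inE size_map sz_w => lt_i lt_i'.
  rewrite !(nth_map (0, false)) ?sz_w //.
  have [j lt_j [s_j ->]] := wP i lt_i; have [j' lt_j' [s_j' ->]] := wP i' lt_i'.
  by case=> Ej; apply: (col j) => //; rewrite Ej.
split=> //; apply: uniq_perm => //; first exact: iota_uniq.
have sub_w : {subset map fst w <= iota 1 n}.
  move=> x /mapP[y /(nthP (0, false))[i]]; rewrite sz_w => lt_i <- ->.
  by have [j lt_j [_ ->]] := wP i lt_i; rewrite mem_iota add1n ltnS.
have le_sz : size (iota 1 n) <= size (map fst w) by rewrite size_iota size_map sz_w.
by have [] := uniq_min_size uniq_w sub_w le_sz.
Qed.

Lemma grid_back_inj n (G G' : nat -> nat -> part) (M M' : nat -> nat -> option bool) :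
  (forall i j, i < n -> j < n -> grow (M i j) (G i j) (G i.+1 j) (G i j.+1) (G i.+1 j.+1)) ->
  (forall i j, i < n -> j < n -> grow (M' i j) (G' i j) (G' i.+1 j) (G' i j.+1) (G' i.+1 j.+1)) ->
  (forall j, j <= n -> G n j = G' n j) -> (forall i, i <= n -> G i n = G' i n) ->
  forall i j, i < n -> j < n -> M i j = M' i j.
Proof.
move=> gr gr' bot rgt.
(* Coordinates are counted from the bottom right corner, so that induction runs backwards through
   the diagram. *)
have EG i j : i <= n -> j <= n -> G (n - i) (n - j) = G' (n - i) (n - j).
  elim: i j => [|i IHi] j lt_i; first by rewrite subn0 => _; apply/bot/leq_subr.
  elim: j => [|j IHj] lt_j; first by rewrite subn0 rgt ?leq_subr.
  have {IHi} := (IHi j (ltnW lt_i) (ltnW lt_j), IHi j.+1 (ltnW lt_i) lt_j, IHj (ltnW lt_j)).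
  rewrite (_ : n - i = (n - i.+1).+1) 1?(_ : n - j = (n - j.+1).+1); try by lia.
  have lt_ni : n - i.+1 < n by lia.
  have lt_nj : n - j.+1 < n by lia.
  move: (gr _ _ lt_ni lt_nj) (gr' _ _ lt_ni lt_nj) => g g' [[E1 E2] E3].
  by rewrite E1 E2 E3 in g; case: (grow_la_inj g g').
move=> i j lt_i lt_j; have := gr' i j lt_i lt_j.
have EG' a b : a <= n -> b <= n -> G a b = G' a b.
  by move=> la lb; rewrite -(subKn la) -(subKn lb) EG ?leq_subr.
rewrite -!EG' ?(ltnW lt_i) ?(ltnW lt_j) //.
by case/(grow_la_inj (gr i j lt_i lt_j)).
Qed.

Lemma Bn_ext n w1 w2 : in_Bn n w1 -> in_Bn n w2 ->
  (forall i j, i < n -> j < n -> Mentry w1 i j = Mentry w2 i j) -> w1 = w2.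
Proof.
move=> w1B w2B EM; apply: (@eq_from_nth _ (0, false)); rewrite (Bn_size w1B) ?(Bn_size w2B) //.
move=> i lt_i; have /andP[pos le_n] := letter_bounds w1B lt_i.
(* In the column of the letter of [w1] its entry is nonzero, so [w2] has the same letter and the
   same bar. *)
have := EM i _.-1 lt_i (leq_trans (eq_leq (prednK pos)) le_n).
rewrite /Mentry prednK // eqxx; case: eqP => // E1 [E2].
by apply/eqP; rewrite [_ == _]xpair_eqE; apply/andP; split; apply/eqP.
Qed.

(** * Tableaux as chains of partitions, and the spin count *)

Lemma SDT_mkseq r n (f : nat -> part) : f 0 = delta r ->
  (forall i, i < n -> exists d, step d (f i) (f i.+1)) ->
  is_SDT r (f n) (mkseq f n.+1).
Proof.
move=> f0 st; rewrite /mkseq /= f0; split=> //; split.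
  apply/(pathP [::]) => i; rewrite size_map size_iota => lt_i.
  have Ei k : k <= n -> nth [::] (delta r :: [seq f i | i <- iota 1 n]) k = f k.
    by case: k => [//|k] lt_k; rewrite /= (nth_map 0) ?size_iota // nth_iota.
  rewrite Ei ?(ltnW lt_i) // (_ : nth _ _ i = f i.+1); last exact: (Ei i.+1).
  by have [d] := st i lt_i; apply: step_dstep.
case: n {st} => [//|n]; rewrite -[n.+1]addn1 iotaD map_cat last_cat /= add1n addn1 //.
Qed.

(** Each step adds two cells, so the size of the shape determines the length of the chain. *)
Lemma SDT_chain r la T : is_SDT r la T ->
  exists n (f : nat -> part), [/\ T = mkseq f n.+1, f 0 = delta r, f n = la,
    forall i, i < n -> exists d, step d (f i) (f i.+1)
    & sumn la = sumn (delta r) + 2 * n].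
Proof.
case: T => //= c s [-> [p last_s]].
exists (size s), (nth [::] (delta r :: s)).
have st i : i < size s -> exists d, step d (nth [::] (delta r :: s) i) (nth [::] (delta r :: s) i.+1).
  by move=> lt_i; apply: dstepP; have /(pathP [::])/(_ i lt_i) := p.
split=> //.
- by rewrite -[(size s).+1]/(size (delta r :: s)) mkseq_nth.
- by rewrite nth_last.
have sum_i k : k <= size s -> sumn (nth [::] (delta r :: s) k) = sumn (delta r) + 2 * k.
  elim: k => [|k IHk] lt_k; first by rewrite addn0.
  by have [d /step_sumn->] := st k lt_k; rewrite IHk ?(ltnW lt_k) // mulnS; lia.
by rewrite -sum_i // nth_last /= last_s.
Qed.

Lemma nvert_mkseq (f : nat -> part) n :
  nvert (mkseq f n.+1) = \sum_(i < n) vdom (f i) (f i.+1).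
Proof.
have mkS g m : mkseq g m.+1 = g 0 :: mkseq (fun i => g i.+1) m :> seq part.
  by rewrite /mkseq /= -[1]addn0 iotaDl -map_comp.
elim: n f => [|n IHn] f; first by rewrite big_ord0.
by rewrite big_ord_recl -(IHn (fun i => f i.+1)) (mkS f) (mkS _ n).
Qed.

Lemma tc_Mentry n w : in_Bn n w ->
  tc w = \sum_(i < n) \sum_(j < n) (Mentry w i j == Some true).
Proof.
move=> wB; rewrite /tc -sum1_count big_mkcond (big_nth (0, false)) (Bn_size wB) big_mkord.
apply: eq_bigr => i _; have /andP[pos le_n] := letter_bounds wB (ltn_ord i).
have lt_p : (nth (0, false) w i).1.-1 < n by rewrite prednK.
rewrite (bigD1 (Ordinal lt_p)) //= big1 => [|j ne_j].
  by rewrite /Mentry prednK // eqxx addn0; case: (nth _ _ _).2.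
rewrite /Mentry; case: (_ =P j.+1) => // E; case/eqP: ne_j.
by apply: val_inj; rewrite /= E.
Qed.

(** Summing the square identity along a row cancels the inner [v], and summing over rows cancels the
    inner [h]; only the last row and column survive. *)
Lemma grid_nvert n (h v c : nat -> nat -> nat) :
  (forall i j, i < n -> j < n -> v i j.+1 + h i.+1 j = h i j + v i j + (c i j).*2) ->
  (forall j, j < n -> h 0 j = 0) -> (forall i, i < n -> v i 0 = 0) ->
  \sum_(i < n) v i n + \sum_(j < n) h n j = (\sum_(i < n) \sum_(j < n) c i j).*2.
Proof.
move=> eq_c h0 v0.
have row i k : i < n -> k <= n ->
    v i k + \sum_(j < k) h i.+1 j = \sum_(j < k) h i j + (\sum_(j < k) c i j).*2.
  move=> lt_i; elim: k => [|k IHk] lt_k; first by rewrite !big_ord0 v0.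
  rewrite !big_ord_recr /=; have := IHk (ltnW lt_k); have := eq_c i k lt_i lt_k.
  move: (\sum_(j < k) h i.+1 j) (\sum_(j < k) h i j) (\sum_(j < k) c i j); lia.
have col k : k <= n -> \sum_(i < k) v i n + \sum_(j < n) h k j
    = (\sum_(i < k) \sum_(j < n) c i j).*2.
  elim: k => [|k IHk] lt_k; first by rewrite !big_ord0 big1 // => j _; apply: h0.
  rewrite !big_ord_recr /=; have := IHk (ltnW lt_k); have := row k n lt_k (leqnn n).
  move: (\sum_(i < k) v i n) (\sum_(j < n) h k j) (\sum_(j < n) h k.+1 j).
  move: (\sum_(i < k) \sum_(j < n) c i j) (\sum_(j < n) c k j); lia.
exact: col.
Qed.

Lemma word_nvert r n w : in_Bn n w -> nvert (Pd r w) + nvert (Qd r w) = (tc w).*2.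
Proof.
move=> wB; rewrite Pd_grid Qd_grid !nvert_mkseq (Bn_size wB) (tc_Mentry wB) addnC.
have vd0 x : vdom x x = 0 by rewrite /vdom skew_id.
apply: (@grid_nvert n (fun i j => vdom (grid r w i j) (grid r w i j.+1))
  (fun i j => vdom (grid r w i j) (grid r w i.+1 j)) (fun i j => Mentry w i j == Some true)).
- by move=> i j lt_i lt_j; apply/grow_vdom/(grid_grow r wB).
- by move=> j lt_j; rewrite !grid_top ?(Bn_size wB) // ltnW.
by move=> i lt_i; rewrite !grid_left.
Qed.

Lemma mkseq_inj_on (T : Type) (f g : nat -> T) n :
  mkseq f n = mkseq g n -> forall i, i < n -> f i = g i.
Proof.
by move=> E i lt_i; have := congr1 (fun s => nth (f i) s i) E; rewrite !nth_mkseq.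
Qed.

Lemma word_SDT r n w : in_Bn n w ->
  is_SDT r (grid r w n n) (Pd r w) /\ is_SDT r (grid r w n n) (Qd r w).
Proof.
move=> wB; rewrite Pd_grid Qd_grid (Bn_size wB); split.
  by apply: SDT_mkseq => [|i]; [apply: grid_left | apply: grid_last_row].
apply: (@SDT_mkseq r n (fun i => grid r w i n)) => [|i].
  by rewrite grid_top ?(Bn_size wB).
exact: grid_last_col.
Qed.

Lemma word_inj r n w1 w2 : in_Bn n w1 -> in_Bn n w2 ->
  Pd r w1 = Pd r w2 -> Qd r w1 = Qd r w2 -> w1 = w2.
Proof.
move=> w1B w2B; rewrite !Pd_grid !Qd_grid (Bn_size w1B) (Bn_size w2B).
move=> /mkseq_inj_on EP /mkseq_inj_on EQ; apply: (Bn_ext w1B w2B).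
exact: (grid_back_inj (grid_grow r w1B) (grid_grow r w2B) EP EQ).
Qed.

Lemma word_surj r n la P Q : sumn la = sumn (delta r) + 2 * n ->
  is_SDT r la P -> is_SDT r la Q -> exists w, in_Bn n w /\ (Pd r w, Qd r w) = (P, Q).
Proof.
move=> sum_la /SDT_chain[nP [lo [-> lo0 lo_n st_lo sumP]]].
case/SDT_chain=> nQ [q [-> q0 q_n st_q sumQ]].
(* Both chains end at [la], whose size fixes their common length; they become the last row and last
   column of the diagram to rebuild. *)
have [EnP EnQ] : nP = n /\ nQ = n by lia.
subst nP nQ.
have plo j : j <= n -> is_part (lo j).
  by case: j => [|j lt_j]; rewrite ?lo0 ?delta_part //; have [d []] := st_lo j lt_j.
have [|||G [M [G_lo G_q pG vG gG]]] := @grid_back n n lo q plo.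
- by move=> j /st_lo; right.
- by rewrite q_n lo_n.
- by move=> i /st_q; right.
have [|||w [wB Gw]] := @grid_word r n G M pG vG gG.
- by rewrite G_lo.
- by rewrite G_q.
- move=> i lt_i; rewrite !G_q ?(ltnW lt_i) //; have [d] := st_q i lt_i.
  by case: eqP => // -> /step_irr.
exists w; split=> //; rewrite Pd_grid Qd_grid (Bn_size wB).
congr (_, _); apply: (@eq_from_nth _ [::]); rewrite !size_mkseq // => i lt_i;
  rewrite !nth_mkseq // Gw //; [exact: G_lo | exact: G_q].
Qed.

Theorem theorem2p2 (r n : nat) :
  (forall w : sword, in_Bn n w ->
     exists la : part, [/\ in_Prn r n la, is_SDT r la (Pd r w) & is_SDT r la (Qd r w)])
  /\ (forall w1 w2 : sword, in_Bn n w1 -> in_Bn n w2 ->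
        (Pd r w1, Qd r w1) = (Pd r w2, Qd r w2) -> w1 = w2)
  /\ (forall (la : part) (P Q : seq part), in_Prn r n la -> is_SDT r la P -> is_SDT r la Q ->
        exists w : sword, in_Bn n w /\ (Pd r w, Qd r w) = (P, Q))
  /\ (forall w : sword, in_Bn n w ->
        ((tc w)%:R : rat) = (sp (Pd r w) + sp (Qd r w))%R).
Proof.
split=> [w wB|].
  have [SP SQ] := word_SDT r wB; exists (grid r w n n); split=> //; split.
    split; [exact: delta_part | split; [exact: delta_no_removable|]].
    case: (Pd r w) SP => // c s [-> [path_s last_s]].
    by exists s.
  (* The size of the final shape is read off the chain, whose length is that of a row of the
     diagram. *)
  have [m [f [Ef _ _ _ ->]]] := SDT_chain SP.
  have /eqP := congr1 size Ef; rewrite size_mkseq size_growth_row (Bn_size wB).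
  by rewrite eqSS => /eqP->.
split=> [w1 w2 w1B w2B EPQ|].
  exact: word_inj w1B w2B (congr1 fst EPQ) (congr1 snd EPQ).
split=> [la P Q [_ sum_la]|w wB]; first exact: word_surj.
rewrite /sp -GRing.mulrDl -GRing.natrD (word_nvert r wB) -muln2 GRing.natrM.
by rewrite GRing.mulfK.
Qed.
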